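(* Let $(X_n)_{n\in\mathbb{N}}$ be a Wasserstein contractive Markov chain with transition kernel $P$, unique invariant distribution $\pi$ and initial distribution $\nu$ (so $X_1\sim\nu$). Assume that $\delta:=\sup_{x,y\in\mathcal{X}}d(x,y)<\infty$, that $\nu\ll\pi$ and that $\frac{d\nu}{d\pi}\in L^q(\pi)$ for some $q\in(1,\infty)$. Then for any $n\in\mathbb{N}$, $$\sup_{f\in\mathscr{L}_0;\ \|f\|_d\le1}\mathbb{E}_\nu\left[(S_n^*f)^2\right]\le 32\,C^{2}\,n\left\|\frac{d\nu}{d\pi}\right\|_{L^q(\pi)}+2C^2,$$ where $C=\delta\cdot\Lambda$.
   Context: $(\mathcal{X},\rho)$ is a non-trivial (more than one point) Polish space with Borel $\sigma$-algebra $\mathcal{B}(\mathcal{X})$, and $d:\mathcal{X}\times\mathcal{X}\to[0,\infty)$ is a metric that is lower semi-continuous with respect to the product topology induced by $\rho$. For probability measures $\mu_1,\mu_2$ on $\mathcal{X}$, $\mathcal{W}(\mu_1,\mu_2)=\inf_{\eta}\int d(x,y)\,\eta(dx,dy)$, the infimum running over all couplings $\eta$ of $\mu_1,\mu_2$. For a Markov kernel $K$ on $\mathcal{X}$, $\tau(K)=\sup_{x\ne y}\mathcal{W}(K(x,\cdot),K(y,\cdot))/d(x,y)$; $K^n$ is the $n$-th iterate, $K^0$ the identity kernel. A Markov chain with transition kernel $P$ is Wasserstein contractive if $\tau(P)<\infty$ and $\tau(P^m)<1$ for some $m\in\mathbb{N}=\{1,2,\dots\}$; in that case $\Lambda:=\sum_{n=0}^\infty\tau(P^n)<\infty$.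 $\|f\|_d:=\sup_{x\neq y}|f(x)-f(y)|/d(x,y)$; $\mathscr{L}$ is the space of all measurable $f:\mathcal{X}\to\mathbb{R}$ with $\|f\|_d<\infty$, and $\mathscr{L}_0=\{f\in\mathscr{L}:\int f\,d\pi=0\}$. $\mathbb{E}_\nu$ is expectation for the chain started from $X_1\sim\nu$. $S_n^*f=\max_{1\le k\le n}\left|\sum_{j=1}^kf(X_j)\right|$. *)

(* Defs.v *)
From HB Require Import structures.
From mathcomp Require Import all_boot all_order all_algebra.
From mathcomp Require Import all_classical all_reals all_analysis.

Set Implicit Arguments.
Unset Strict Implicit.
Unset Printing Implicit Defensive.

Import Order.TTheory GRing.Theory Num.Theory.
Import numFieldNormedType.Exports.

Local Open Scope classical_set_scope.
Local Open Scope ring_scope.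
Local Open Scope ereal_scope.

(* A complete separable metric space, with distance [mdist], whose
   measurable sets are the Borel sets. *)
HB.mixin Record isPolishBorel (disp : measure_display) (R : realType) T
    & Complete T & Metric R T & Measurable disp T := {
  polish_separable : exists2 S : set T, countable S & dense S ;
  polish_borelE : @measurable disp T = <<s @open T >> }.

#[short(type="polishBorelType")]
HB.structure Definition PolishBorel (disp : measure_display) (R : realType) :=
  {T of Complete T & Metric R T & Measurable disp T & isPolishBorel disp R T}.

Definition is_metric (R : realType) (T : Type) (d : T -> T -> R) : Prop :=
  [/\ forall x y, (0 <= d x y)%R,
      forall x y, d x y = 0%R <-> x = y,
      forall x y, d x y = d y x
    & forall x y z, (d x z <= d x y + d y z)%R].

Section kernel_iterates.
Context disp (T : measurableType disp) (R : realType).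
Implicit Types K L : R.-pker T ~> T.

Definition kcomp2 K L : T -> {measure set T -> \bar R} := mkcomp_noparam K L.

Lemma kcomp2_setT K L x : kcomp2 K L x setT = 1.
Proof.
rewrite /kcomp2 /mkcomp_noparam /= /kcomp_noparam.
under eq_integral do rewrite prob_kernel.
by rewrite integral_cst// prob_kernel mule1.
Qed.

HB.instance Definition _ K L := SubProbabilityKernel.on (kcomp2 K L).
HB.instance Definition _ K L :=
  isProbabilityKernel.Build _ _ T T R (kcomp2 K L) (kcomp2_setT K L).

Fixpoint kiter K (n : nat) : R.-pker T ~> T :=
  if n is n'.+1 then kcomp2 K (kiter K n') else kdirac (@measurable_id _ T setT).

Definition invariant_measure K (mu : probability T R) : Prop :=
  forall A, measurable A -> mu A = \int[mu]_x K x A.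

End kernel_iterates.

Section wasserstein.
Context disp (T : measurableType disp) (R : realType) (d : T -> T -> R).

Definition coupling (mu1 mu2 : set T -> \bar R) :
    set (probability (T * T)%type R) :=
  [set eta | (forall A, measurable A -> eta (A `*` setT) = mu1 A) /\
             (forall A, measurable A -> eta (setT `*` A) = mu2 A)].

Definition wasserstein (mu1 mu2 : set T -> \bar R) : \bar R :=
  ereal_inf [set \int[eta]_z (d z.1 z.2)%:E | eta in coupling mu1 mu2].

Definition tau (K : R.-pker T ~> T) : \bar R :=
  ereal_sup [set wasserstein (K z.1) (K z.2) * ((d z.1 z.2)^-1)%:E
            | z in [set z : T * T | z.1 <> z.2]].

Definition wasserstein_contractive (P : R.-pker T ~> T) : Prop :=
  tau P < +oo /\ exists2 m : nat, (0 < m)%N & tau (kiter P m) < 1.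

Definition Lambda (P : R.-pker T ~> T) : \bar R :=
  \sum_(0 <= n <oo) tau (kiter P n).

Definition diameter : \bar R :=
  ereal_sup [set (d z.1 z.2)%:E | z in [set: T * T]].

Definition lip_norm (f : T -> R) : \bar R :=
  ereal_sup [set (`|f z.1 - f z.2| / d z.1 z.2)%:E
            | z in [set z : T * T | z.1 <> z.2]].

Definition Lip : set (T -> R) :=
  [set f | measurable_fun setT f /\ lip_norm f < +oo].

(* The extended integral of [f] is 0 only if [f] is integrable, since
   [+oo - +oo = -oo]. *)
Definition Lip0 (pi : probability T R) : set (T -> R) :=
  [set f | Lip f /\ \int[pi]_x (f x)%:E = 0].

End wasserstein.

Section markov_chain.
Context dO (Omega : measurableType dO) disp (T : measurableType disp)
  (R : realType) (Pr : probability Omega R).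

(* Chains are indexed from 0: [X n] is the state $X_{n+1}$ of a chain
   $X_1, X_2, \dots$, so that [X 0] has the initial distribution. *)
Definition natural_filtration (X : nat -> {RV Pr >-> T}) (n : nat) :
    set (set Omega) :=
  <<s \bigcup_(k in `I_n.+1) preimage_set_system setT (X k) measurable >>.

Definition markov_chain (P : R.-pker T ~> T) (nu : probability T R)
    (X : nat -> {RV Pr >-> T}) : Prop :=
  (forall A, measurable A -> distribution Pr (X 0%N) A = nu A) /\
  (forall n A E, measurable A -> natural_filtration X n E ->
     Pr (E `&` X n.+1 @^-1` A) = \int[Pr]_(w in E) P (X n w) A).

Definition max_partial_sum (X : nat -> {RV Pr >-> T}) (f : T -> R) (n : nat)
    (w : Omega) : R :=
  \big[Num.max/0%R]_(1 <= k < n.+1) `|\sum_(0 <= j < k) f (X j w)|%R.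

End markov_chain.

(* Main.v *)
Require Import Defs.
From HB Require Import structures.
From mathcomp Require Import all_boot all_order all_algebra.
From mathcomp Require Import all_classical all_reals all_analysis.
From mathcomp Require Import measurable_realfun.
From mathcomp Require Import ring lra.

(** Write P v x for the integral of v against P x. Integrating a function f that
    is 1-Lipschitz for d against two probability measures gives values that
    differ by at most their Wasserstein distance [le_wasserstein], so P^j f is
    tau(P^j)-Lipschitz. If moreover f has mean 0 for the invariant measure pi,
    then so has P^j f, and a function with mean 0 is bounded by its oscillation:
    |P^j f| <= tau(P^j) delta. Hence the truncated potentials
    v_m = f + P f + ... + P^(m-1) f, which satisfy v_(m+1) = f + P v_m, are all
    bounded by C = delta Lambda [truncated_potential_le].

    With n fixed, put w_k = v_(n-k). Then
    f (X_k) = w_k (X_k) - (P w_(k+1)) (X_k) for every k < n, with indices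
    from 0, and the sum telescopes: up to the term
    (P w_k) (X_(k-1)), which is bounded by C, the sum of the first k values of f
    along the chain is the value at time k - 1 of the process M that starts at
    w_0 (X_0) and has increments D_j = w_(j+1) (X_(j+1)) - (P w_(j+1)) (X_j). By
    the Markov property D_j is orthogonal to every bounded function of
    X_0, ..., X_j [markov_orthogonality], so M is a martingale, with increments
    bounded by 2 C.

    The maximal inequality of Doob bounds the expectation of (max |M|)^2 by 4
    times C^2 + (n - 1) (2 C)^2. It is used in a pathwise form [doob_pathwise]:
    a deterministic inequality bounds (max |M|)^2 by 4 times the quadratic
    variation plus a sum of terms H_j D_j with H_j a function of the past, and
    such terms have expectation 0. This gives the bound 32 C^2 n + 2 C^2 for
    every initial distribution [expectation_sqr_max_partial_sum_le]. The L^q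
    norm of the density is at least 1 [Lnorm_density_ge1], which yields the
    bound of the theorem. *)

Set Implicit Arguments.
Unset Strict Implicit.
Unset Printing Implicit Defensive.

Import Order.TTheory GRing.Theory Num.Theory.
Import numFieldNormedType.Exports.

Local Open Scope classical_set_scope.
Local Open Scope ring_scope.
Local Open Scope charge_scope.
Local Open Scope ereal_scope.

(** * A pathwise maximal inequality *)

Section pathwise_doob.
Context (R : realDomainType).
Implicit Type M : nat -> R.
Local Open Scope ring_scope.

Fixpoint running_max M (n : nat) : R :=
  if n is k.+1 then Num.max (running_max M k) `|M k.+1| else `|M 0%N|.

Lemma running_max_ge M n k : (k <= n)%N -> `|M k| <= running_max M n.
Proof.
elim: n => [|n IHn]; first by rewrite leqn0 => /eqP ->.
rewrite leq_eqVlt => /predU1P[->|kn] /=; first by rewrite le_max lexx orbT.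
by rewrite le_max IHn.
Qed.

(** The coefficient of the increment at time [k] once two transforms are
    merged: the one of the running maximum, and the one that appears when the
    square of the endpoint is expanded. It depends on [M 0], ..., [M k] only,
    so a martingale difference is orthogonal to it. *)
Definition doob_weight M (k : nat) : R :=
  8%:R * M k - 4%:R * (running_max M k * Num.sg (M k)).

(* With S the running maximum, 2 S |M| - S^2 grows at each step at least by
   2 S (|M'| - |M|): equality holds if S does not move, and otherwise the gap
   is the square (|M'| - S)^2. Convexity of the absolute value then brings in
   the increments of M itself. *)
Let running_max_transform M n :
  2%:R * (\sum_(k < n) running_max M k * Num.sg (M k) * (M k.+1 - M k))
  <= 2%:R * running_max M n * `|M n| - running_max M n ^+ 2.
Proof.
elim: n => [|n IHn].
  by rewrite big_ord0 mulr0 /= -mulrA -expr2 mulr2n mulrDl mul1r addrK sqr_ge0.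
rewrite big_ord_recr /= mulrDr.
have S0 : 0 <= running_max M n.
  exact: le_trans (normr_ge0 _) (running_max_ge M (leqnn n)).
have := running_max_ge M (leqnn n).
move: IHn; set S := running_max M n; set A := \sum_(_ < _) _ => IHn MS.
have sM : Num.sg (M n) * M n = `|M n| by rewrite normrEsg.
have sM' : Num.sg (M n) * M n.+1 <= `|M n.+1|.
  case: sgrP => _; rewrite ?mul0r ?mul1r ?mulN1r //; first exact: ler_norm.
  by rewrite -normrN ler_norm.
have -> : S * Num.sg (M n) * (M n.+1 - M n)
    = S * (Num.sg (M n) * M n.+1) - S * `|M n| by rewrite -sM; ring.
have := ler_wpM2l S0 sM'; rewrite -/S.
set b := S * (_ * _); case: (leP S `|M n.+1|) => h.
(* here the running maximum jumps to |M n.+1| *)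
- set a := `|M n.+1|; move=> hb.
  by have := sqr_ge0 (a - S); lra.
- by move=> hb; lra.
Qed.

Let sqr_telescope M n :
  M n ^+ 2 = M 0%N ^+ 2 + \sum_(k < n) (M k.+1 - M k) ^+ 2
    + 2%:R * \sum_(k < n) M k * (M k.+1 - M k).
Proof.
elim: n => [|n IHn]; first by rewrite !big_ord0; ring.
rewrite !big_ord_recr /= mulrDr.
have -> : M n.+1 ^+ 2 = M n ^+ 2 + (M n.+1 - M n) ^+ 2
    + 2%:R * (M n * (M n.+1 - M n)) by ring.
rewrite IHn; ring.
Qed.

(** A pathwise form of the quadratic maximal inequality of Doob. The bound
    S^2 <= 4 M^2 + transform comes from S^2 <= 2 S |M| + transform and
    2 S |M| <= S^2 / 2 + 2 M^2; the square of the endpoint is then replaced by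
    the quadratic variation. Taking expectations is all that remains to be
    done for a martingale. *)
Lemma doob_pathwise M n :
  running_max M n ^+ 2 <=
    4%:R * (M 0%N ^+ 2 + \sum_(k < n) (M k.+1 - M k) ^+ 2)
    + \sum_(k < n) doob_weight M k * (M k.+1 - M k).
Proof.
have -> : \sum_(k < n) doob_weight M k * (M k.+1 - M k) =
    8%:R * (\sum_(k < n) M k * (M k.+1 - M k)) -
    4%:R * (\sum_(k < n) running_max M k * Num.sg (M k) * (M k.+1 - M k)).
  rewrite !mulr_sumr -sumrB; apply: eq_bigr => k _.
  by rewrite /doob_weight; ring.
have := running_max_transform M n; have := sqr_telescope M n.
set A := \sum_(_ < _) _; set B := \sum_(_ < _) _; set D := \sum_(_ < _) _.
have -> : M n ^+ 2 = `|M n| ^+ 2 by rewrite real_normK ?num_real.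
set S := running_max M n; set a := `|M n| => h1 h2.
have := sqr_ge0 (S - 2%:R * a).
lra.
Qed.

End pathwise_doob.

(** * Integrals of weighted kernels *)

Section weighted_kernel.
Context d (Y : measurableType d) (R : realType).
Import HBNNSimple.

(** The right-hand side depends on the measure, the weight and the kernel only
    through the set function that sends [A] to the integral of [u w * k w A];
    this makes it the tool to compare two such integrals. *)
Lemma ge0_integral_weighted_kernel_approx d1 (W : measurableType d1)
    (m : {measure set W -> \bar R})
    (k : W -> {measure set Y -> \bar R})
    (mk : forall A, measurable A -> measurable_fun [set: W] (k ^~ A))
    (u : W -> \bar R) (mu_ : measurable_fun [set: W] u)
    (u0 : forall w, 0 <= u w) (ufin : forall w, u w \is a fin_num)
    (v : Y -> \bar R) (mv : measurable_fun [set: Y] v)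
    (v0 : forall y, 0 <= v y) :
  \int[m]_w (u w * \int[k w]_y v y) =
  limn (fun n => \sum_(r \in range (nnsfun_approx measurableT mv n))
    (r%:E * \int[m]_w
      (u w * k w (nnsfun_approx measurableT mv n @^-1` [set r])))).
Proof.
set v_ := nnsfun_approx measurableT mv.
have ndv a b : (a <= b)%N -> forall y, ((v_ a y)%:E <= (v_ b y)%:E).
  by move=> ab y; rewrite lee_fin; exact/lefP/nd_nnsfun_approx.
have v_0 n y : 0 <= (v_ n y)%:E by rewrite lee_fin.
have mv_ n : measurable_fun setT (fun y => (v_ n y)%:E).
  exact/measurable_EFinP.
have int_ndv w a b : (a <= b)%N ->
    \int[k w]_y (v_ a y)%:E <= \int[k w]_y (v_ b y)%:E.
  by move=> ab; apply: ge0_le_integral => // y _; exact: ndv.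
have int0 w n : 0 <= \int[k w]_y (v_ n y)%:E by apply: integral_ge0.
have mint n : measurable_fun setT (fun w => \int[k w]_y (v_ n y)%:E).
  exact: measurable_fun_integral_kernel.
transitivity (\int[m]_w limn (fun n => u w * \int[k w]_y (v_ n y)%:E)).
  apply: eq_integral => w _; apply/esym/cvg_lim => //.
  apply: cvgeZl => //.
  rewrite [X in _ --> X](_ : _ = \int[k w]_y limn (fun n => (v_ n y)%:E)).
    by apply: cvg_monotone_convergence => // y _ a b ab; exact: ndv.
  apply: eq_integral => y _; apply/esym/cvg_lim => //.
  exact: cvg_nnsfun_approx.
rewrite monotone_convergence//; last 3 first.
- by move=> n; exact: emeasurable_funM.
- by move=> n w _; exact: mule_ge0.
- by move=> w _ a b ab; apply: lee_wpmul2l => //; exact: int_ndv.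
congr (limn _); apply/funext => n.
have nnkr r w : 0 <= r%:E * k w (v_ n @^-1` [set r]).
  exact: nnsfun_mulemu_ge0.
transitivity (\int[m]_w (\sum_(r \in range (v_ n))
   (r%:E * (u w * k w (v_ n @^-1` [set r]))))).
  apply: eq_integral => w _.
  rewrite integralT_nnsfun sintegralE ge0_mule_fsumr//.
  by apply: eq_fsbigr => r _; rewrite muleCA.
rewrite ge0_integral_fsum//; last 2 first.
- move=> r; apply: measurable_funeM; apply: emeasurable_funM => //; exact: mk.
- by move=> r w _; rewrite muleCA mule_ge0.
apply: eq_fsbigr => r /[!inE] -[y _ vr].
rewrite ge0_integralZl//; last by rewrite -vr.
- by apply: emeasurable_funM => //; exact: mk.
- by move=> w _; exact: mule_ge0.
Qed.

(** The extension from sets to nonnegative functions behind all the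
    disintegrations below. With Dirac kernels and weights, the same statement
    covers mixtures of kernels and the passage from the events of a
    sub-sigma-algebra to the functions that it makes measurable. *)
Lemma eq_ge0_integral_weighted_kernel d1 d2
    (W1 : measurableType d1) (W2 : measurableType d2)
    (m1 : {measure set W1 -> \bar R}) (m2 : {measure set W2 -> \bar R})
    (k1 : W1 -> {measure set Y -> \bar R})
    (k2 : W2 -> {measure set Y -> \bar R})
    (u1 : W1 -> \bar R) (u2 : W2 -> \bar R) (v : Y -> \bar R) :
    (forall A, measurable A -> measurable_fun [set: W1] (k1 ^~ A)) ->
    (forall A, measurable A -> measurable_fun [set: W2] (k2 ^~ A)) ->
    measurable_fun [set: W1] u1 -> measurable_fun [set: W2] u2 ->
    (forall w, 0 <= u1 w) -> (forall w, 0 <= u2 w) ->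
    (forall w, u1 w \is a fin_num) -> (forall w, u2 w \is a fin_num) ->
    measurable_fun [set: Y] v -> (forall y, 0 <= v y) ->
    (forall A, measurable A ->
      \int[m1]_w (u1 w * k1 w A) = \int[m2]_w (u2 w * k2 w A)) ->
  \int[m1]_w (u1 w * \int[k1 w]_y v y) = \int[m2]_w (u2 w * \int[k2 w]_y v y).
Proof.
move=> mk1 mk2 mu1 mu2 u10 u20 fu1 fu2 mv v0 k12.
rewrite (ge0_integral_weighted_kernel_approx m1 mk1 mu1 u10 fu1 mv v0).
rewrite (ge0_integral_weighted_kernel_approx m2 mk2 mu2 u20 fu2 mv v0).
by congr (limn _); apply/funext => n; apply: eq_fsbigr => r _; rewrite k12.
Qed.

End weighted_kernel.

(** * Bounded measurable functions and their means *)

Lemma addr_ge0_normr_le (R : realDomainType) (x B : R) :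
  (`|x| <= B -> 0 <= x + B)%R.
Proof. by rewrite -lerBlDr sub0r ler_norml => /andP[]. Qed.

Section bounded_measurable.
Context d (T : measurableType d) (R : realType).
Implicit Types f g : T -> R.

Definition bounded_measurable f :=
  measurable_fun [set: T] f /\ exists B : R, forall x, (`|f x| <= B)%R.

Lemma bounded_measurable_cst (r : R) : bounded_measurable (fun=> r).
Proof. by split; [exact: measurable_cst|exists `|r|%R]. Qed.

Lemma bounded_measurableD f g : bounded_measurable f -> bounded_measurable g ->
  bounded_measurable (fun x => f x + g x)%R.
Proof.
move=> [mf [B fB]] [mg [C gC]]; split; first exact: measurable_funD.
by exists (B + C)%R => x; rewrite (le_trans (ler_normD _ _))// lerD.
Qed.

Lemma bounded_measurableM f g : bounded_measurable f -> bounded_measurable g ->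
  bounded_measurable (fun x => f x * g x)%R.
Proof.
move=> [mf [B fB]] [mg [C gC]]; split; first exact: measurable_funM.
by exists (B * C)%R => x; rewrite normrM ler_pM.
Qed.

Lemma bounded_measurableB f g : bounded_measurable f -> bounded_measurable g ->
  bounded_measurable (fun x => f x - g x)%R.
Proof.
move=> [mf [B fB]] [mg [C gC]]; split; first exact: measurable_funB.
by exists (B + C)%R => x; rewrite (le_trans (ler_normB _ _))// lerD.
Qed.

Lemma bounded_measurable_norm f : bounded_measurable f ->
  bounded_measurable (fun x => `|f x|)%R.
Proof.
move=> [mf [B fB]]; split; first exact: measurableT_comp.
by exists B => x; rewrite normr_id.
Qed.

Lemma bounded_measurable_max f g : bounded_measurable f ->
  bounded_measurable g -> bounded_measurable (fun x => Num.max (f x) (g x)).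
Proof.
move=> [mf [B fB]] [mg [C gC]]; split; first exact: measurable_maxr.
exists (Num.max B C) => x; rewrite le_max; case: (leP (f x) (g x)) => _.
  by rewrite gC orbT.
by rewrite fB.
Qed.

Lemma bounded_measurable_sg f : bounded_measurable f ->
  bounded_measurable (fun x => Num.sg (f x)).
Proof.
move=> [mf _]; split; last first.
  by exists 1%R => x; rewrite normr_sg; case: (f x != 0%R).
apply: measurable_fun_ifT => //; first exact: measurable_fun_eqr.
by apply: measurable_fun_ifT => //; exact: measurable_fun_ltr.
Qed.

Lemma bounded_measurable_sum (F : nat -> T -> R) n :
  (forall i, (i < n)%N -> bounded_measurable (F i)) ->
  bounded_measurable (fun x => \sum_(i < n) F i x)%R.
Proof.
elim: n => [|n IHn] mF.
  by under eq_fun do rewrite big_ord0; exact: bounded_measurable_cst.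
under eq_fun do rewrite big_ord_recr /=.
apply: bounded_measurableD; last exact: mF.
by apply: IHn => i iN; apply: mF; exact: ltnW.
Qed.

Variables (mu : {measure set T -> \bar R}) (mu1 : mu setT = 1).

Lemma bounded_measurable_integrable f : bounded_measurable f ->
  mu.-integrable setT (EFin \o f).
Proof.
move=> [mf [B fB]]; apply: measurable_bounded_integrable => //.
  by rewrite mu1 ltry.
exists B; split; first exact: num_real.
by move=> M BM x _; exact: le_trans (fB x) (ltW BM).
Qed.

Lemma EFin_Rintegral f : bounded_measurable f ->
  ((\int[mu]_x f x)%R)%:E = \int[mu]_x (f x)%:E.
Proof.
move=> bf; rewrite fineK//; apply: integrable_fin_num => //.
exact: bounded_measurable_integrable.
Qed.

Lemma Rintegral_prob_cst (r : R) : (\int[mu]_x r = r)%R.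
Proof. by rewrite Rintegral_cst// mu1 mulr1. Qed.

Lemma Rintegral_bmD f g : bounded_measurable f -> bounded_measurable g ->
  (\int[mu]_x (f x + g x) = \int[mu]_x f x + \int[mu]_x g x)%R.
Proof.
by move=> bf bg; apply: RintegralD => //; exact: bounded_measurable_integrable.
Qed.

Lemma Rintegral_bmB f g : bounded_measurable f -> bounded_measurable g ->
  (\int[mu]_x (f x - g x) = \int[mu]_x f x - \int[mu]_x g x)%R.
Proof.
by move=> bf bg; apply: RintegralB => //; exact: bounded_measurable_integrable.
Qed.

Lemma Rintegral_bm_sum (F : nat -> T -> R) n :
  (forall i, (i < n)%N -> bounded_measurable (F i)) ->
  (\int[mu]_x \sum_(i < n) F i x = \sum_(i < n) \int[mu]_x F i x)%R.
Proof.
elim: n => [|n IHn] mF.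
  rewrite big_ord0 -[RHS]Rintegral_prob_cst.
  by apply: eq_Rintegral => x _; rewrite big_ord0.
have mF' i : (i < n)%N -> bounded_measurable (F i).
  by move=> iN; apply: mF; exact: ltnW.
rewrite big_ord_recr/= -IHn//.
rewrite -Rintegral_bmD//; last 2 first.
- exact: bounded_measurable_sum.
- exact: mF.
by apply: eq_Rintegral => x _; rewrite big_ord_recr.
Qed.

Lemma Rintegral_normr_le f (B : R) : bounded_measurable f ->
  (forall x, `|f x| <= B)%R -> (`|\int[mu]_x f x| <= B)%R.
Proof.
move=> bf fB; have bi := bounded_measurable_integrable bf.
rewrite (le_trans (le_normr_Rintegral measurableT bi))//.
rewrite -[leRHS]Rintegral_prob_cst le_Rintegral//.
- exact: integrable_norm.
- exact/bounded_measurable_integrable/bounded_measurable_cst.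
Qed.

End bounded_measurable.

Lemma bounded_measurable_comp d1 d2 (T1 : measurableType d1)
    (T2 : measurableType d2) (R : realType) (g : T1 -> T2) (f : T2 -> R) :
  measurable_fun [set: T1] g -> bounded_measurable f ->
  bounded_measurable (fun x => f (g x)).
Proof.
by move=> mg [mf [B fB]]; split; [exact: measurableT_comp|exists B].
Qed.

Section kernel_mean.
Context d d' (Y : measurableType d) (Z : measurableType d') (R : realType)
  (K : R.-pker Y ~> Z).

Definition kernel_mean (v : Z -> R) (x : Y) : R := (\int[K x]_y v y)%R.

Lemma kernel_mean_le v (B : R) : bounded_measurable v ->
  (forall y, `|v y| <= B)%R -> forall x, (`|kernel_mean v x| <= B)%R.
Proof.
by move=> bv vB x; apply: Rintegral_normr_le => //; exact: prob_kernel.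
Qed.

Lemma kernel_meanDcst v (r : R) x : bounded_measurable v ->
  kernel_mean (fun y => v y + r)%R x = (kernel_mean v x + r)%R.
Proof.
move=> bv; have K1 := prob_kernel (s := K) x.
rewrite /kernel_mean Rintegral_bmD ?Rintegral_prob_cst//.
exact: bounded_measurable_cst.
Qed.

Lemma bounded_measurable_kernel_mean v : bounded_measurable v ->
  bounded_measurable (kernel_mean v).
Proof.
move=> bv; have [mv [B vB]] := bv; split; last first.
  by exists B => x; exact: kernel_mean_le.
(* the shift by B makes the integrand nonnegative *)
have -> : kernel_mean v = (fun x => kernel_mean (fun y => v y + B)%R x - B)%R.
  by apply/funext => x; rewrite kernel_meanDcst// addrK.
apply: measurable_funB => //.
apply: measurableT_comp => //.
apply: measurable_fun_integral_kernel => //.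
- exact: measurable_kernel.
- by move=> y; rewrite lee_fin addr_ge0_normr_le.
- by apply/measurable_EFinP; exact: measurable_funD.
Qed.

(** Both the composition of two kernels and the invariance of a measure have
    the form of the hypothesis on [mu]; the conclusion reads P (K f) = (P K) f
    in the first case, and pi (P f) = pi f in the second one. *)
Lemma Rintegral_kernel_mixture (m : {measure set Y -> \bar R})
    (mu : {measure set Z -> \bar R}) (f : Z -> R) :
  m setT = 1 -> (forall A, measurable A -> mu A = \int[m]_y K y A) ->
  bounded_measurable f ->
  (\int[mu]_z f z = \int[m]_y kernel_mean f y)%R.
Proof.
move=> m1 muE bf; have [mf [B fB]] := bf.
have K1 y := prob_kernel (s := K) y.
have mu1 : mu setT = 1.
  rewrite muE//; under eq_integral do rewrite K1.
  by rewrite integral_cst// mul1e.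
have bc := bounded_measurable_cst _ B.
have bfB : bounded_measurable (fun z => f z + B)%R.
  exact/bounded_measurableD/bc.
have fB0 z : (0 <= f z + B)%R.
  by rewrite addr_ge0_normr_le.
suff : (\int[mu]_z (f z + B) = \int[m]_y (kernel_mean f y + B))%R.
  rewrite !Rintegral_bmD// ?Rintegral_prob_cst//; first exact: addIr.
  exact: bounded_measurable_kernel_mean.
under [RHS]eq_Rintegral do rewrite -kernel_meanDcst//.
congr fine.
(* compare the kernel K over m with the Dirac kernel over mu *)
transitivity (\int[m]_y (1%:E * \int[K y]_z (f z + B)%:E)); last first.
  by apply: eq_integral => y _; rewrite mul1e EFin_Rintegral.
transitivity (\int[mu]_y
    (1%:E * \int[kdirac (@measurable_id _ Z setT) y]_z (f z + B)%:E)).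
  apply: eq_integral => z _; rewrite mul1e integral_dirac ?diracT ?mul1e//.
  by apply/measurable_EFinP; exact: bfB.1.
apply: eq_ge0_integral_weighted_kernel => //.
- exact: (measurable_kernel
    (kdirac (@measurable_id _ Z setT) : R.-pker Z ~> Z)).
- exact: measurable_kernel.
- by apply/measurable_EFinP; exact: bfB.1.
move=> A mA; under [RHS]eq_integral do rewrite mul1e; rewrite -muE//.
rewrite -[X in _ = mu X](setIT A) -integral_indic//; apply: eq_integral => z _.
by rewrite mul1e.
Qed.

End kernel_mean.

(** * The Markov property for functions *)

Section markov_property.
Context dO (Omega : measurableType dO) disp (T : measurableType disp)
  (R : realType) (Pr : probability Omega R) (X : nat -> {RV Pr >-> T}).

(** The sample space with the sigma-algebra [natural_filtration X n]: a real
    function is adapted at time [n] iff it is measurable on this type. *)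
Definition past (n : nat) :=
  g_sigma_algebraType
    (\bigcup_(k in `I_n.+1) preimage_set_system setT (X k) measurable).

Lemma measurable_past (n k : nat) : (k <= n)%N ->
  measurable_fun [set: past n] (X k : past n -> T).
Proof.
by move=> kn _ B mB; apply: sub_sigma_algebra; exists k => //=; exists B.
Qed.

Lemma measurable_to_past n : measurable_fun [set: Omega] (id : Omega -> past n).
Proof.
move=> _ E mE; rewrite setTI; apply: (smallest_sub _ _ mE).
  exact: sigma_algebra_measurable.
by move=> _ [k _ [B mB <-]]; exact: measurable_funP.
Qed.

Variables (P : R.-pker T ~> T) (nu : probability T R).
Hypothesis XP : markov_chain P nu X.

(* Two extensions of the defining identity, which concerns an event E of the
   past and a set A of states: from E to a weight H with A fixed, and then from
   A to a function v with H fixed. *)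
Let ge0_markov_property n (H : past n -> R) (v : T -> R) :
  measurable_fun [set: past n] H -> (forall w, 0 <= H w)%R ->
  measurable_fun [set: T] v -> (forall y, 0 <= v y)%R ->
  \int[Pr]_w ((H w)%:E * \int[P (X n w)]_y (v y)%:E) =
  \int[Pr]_w ((H w)%:E * (v (X n.+1 w))%:E).
Proof.
move=> mH H0 mv v0.
have mHO : measurable_fun [set: Omega] (H : Omega -> R).
  by apply: (measurableT_comp mH); exact: measurable_to_past.
pose kid := kdirac (@measurable_to_past n) : R.-pker Omega ~> past n.
pose kX := kdirac (measurable_funPT (X n.+1)) : R.-pker Omega ~> T.
have mP A : measurable A -> measurable_fun [set: Omega] (fun w => P (X n w) A).
  move=> mA; exact: (measurableT_comp (measurable_kernel P A mA)
    (measurable_funPT (X n))).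
have Pfin x A : measurable A -> P x A \is a fin_num.
  by move=> mA; apply: (finite_kernel_measure P).
transitivity (\int[Pr]_w ((H w)%:E * \int[kX w]_y (v y)%:E)); last first.
  apply: eq_integral => w _.
  rewrite integral_dirac//; last exact/measurable_EFinP.
  by rewrite diracT mul1e.
apply: eq_ge0_integral_weighted_kernel => //.
- exact: measurable_kernel.
- exact/measurable_EFinP.
- exact/measurable_EFinP.
- exact/measurable_EFinP.
move=> A mA.
have diracH w : \int[kid w]_z (H z)%:E = (H w)%:E.
  rewrite integral_dirac//; last exact/measurable_EFinP.
  by rewrite diracT mul1e.
(* the value H w is an integral against the Dirac mass at w *)
under eq_integral do rewrite muleC -diracH.
under [RHS]eq_integral do rewrite muleC -diracH.
apply: eq_ge0_integral_weighted_kernel => //.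
- exact: measurable_kernel.
- exact: measurable_kernel.
- exact: mP.
- exact: measurable_kernel.
- by move=> w; exact: Pfin.
- exact/measurable_EFinP.
move=> E mE.
have mEO : measurable (E : set Omega).
  by have := @measurable_to_past n measurableT E mE; rewrite setTI.
transitivity (Pr (E `&` X n.+1 @^-1` A)).
  rewrite XP.2//.
  rewrite [RHS]integral_mkcond; apply: eq_integral => w _.
  by rewrite patchE /kid /= diracE; case: ifPn => _; rewrite ?mule1 ?mule0.
rewrite -[X in Pr X]setIT -integral_indic//; last first.
  by apply: measurableI => //; exact: measurable_funPTI.
apply: eq_integral => w _.
by rewrite /kid/kX /= !diracE indicI /= EFinM muleC.
Qed.

(** The innovation v (X n.+1) - (P v) (X n) is a bounded martingale difference:
    it is orthogonal to every bounded function of the past. Adding constants to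
    [H] and [v] reduces this to the nonnegative case, since such a shift of [v]
    leaves the innovation unchanged and a constant weight is itself a function
    of the past. *)
Lemma markov_orthogonality n (H : past n -> R) (v : T -> R) :
  bounded_measurable H -> bounded_measurable v ->
  (\int[Pr]_w (H w * (v (X n.+1 w) - kernel_mean P v (X n w))) = 0)%R.
Proof.
have P1 := @probability_setT _ _ _ Pr.
have bO (g : past n -> R) : bounded_measurable g ->
    bounded_measurable (g : Omega -> R).
  by move=> bg; exact: (bounded_measurable_comp (@measurable_to_past n) bg).
have bX k (v' : T -> R) : bounded_measurable v' ->
    bounded_measurable (fun w => v' (X k w)).
  by move=> bv'; exact: (bounded_measurable_comp (measurable_funPT (X k)) bv').
have bD (v' : T -> R) : bounded_measurable v' ->
    bounded_measurable (fun w => v' (X n.+1 w) - kernel_mean P v' (X n w))%R.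
  by move=> bv'; apply: bounded_measurableB; apply: bX => //;
    exact: bounded_measurable_kernel_mean.
have nonneg (g : past n -> R) (v' : T -> R) : bounded_measurable g ->
    bounded_measurable v' ->
    (forall w, 0 <= g w)%R -> (forall y, 0 <= v' y)%R ->
    (\int[Pr]_w (g w * (v' (X n.+1 w) - kernel_mean P v' (X n w))) = 0)%R.
  move=> bg bv' g0 v'0.
  have bPv' := bounded_measurable_kernel_mean P bv'.
  under eq_Rintegral do rewrite mulrBr.
  rewrite Rintegral_bmB//; last 2 first.
  - by apply: bounded_measurableM; [exact: bO|exact: bX].
  - by apply: bounded_measurableM; [exact: bO|exact: bX].
  apply/eqP; rewrite subr_eq0; apply/eqP; congr fine.
  under eq_integral do rewrite EFinM.
  rewrite -(ge0_markov_property bg.1 g0 bv'.1 v'0).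
  apply: eq_integral => w _; rewrite EFinM; congr (_ * _)%E.
  by rewrite EFin_Rintegral//; exact: prob_kernel.
move=> bH bv; have [_ [B HB]] := bH; have [_ [C vC]] := bv.
have HB0 w : (0 <= H w + B)%R by rewrite addr_ge0_normr_le.
have vC0 y : (0 <= v y + C)%R by rewrite addr_ge0_normr_le.
have bvC : bounded_measurable (fun y => v y + C)%R.
  exact/bounded_measurableD/bounded_measurable_cst.
have B0 : (0 <= B)%R by exact: le_trans (normr_ge0 _) (HB point).
have bHB : bounded_measurable (fun w => H w + B)%R.
  exact/bounded_measurableD/bounded_measurable_cst.
have eqD w : (v (X n.+1 w) - kernel_mean P v (X n w) =
   (v (X n.+1 w) + C) - kernel_mean P (fun y => v y + C) (X n w))%R.
  by rewrite kernel_meanDcst// opprD addrACA subrr addr0.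
pose Z w := ((v (X n.+1 w) + C) -
  kernel_mean P (fun y => v y + C) (X n w))%R.
transitivity (\int[Pr]_w ((H w + B) * Z w - B * Z w))%R.
  by apply: eq_Rintegral => w _; rewrite eqD mulrDl addrK.
rewrite Rintegral_bmB//; last 2 first.
- by apply: bounded_measurableM; [exact: bO|exact: (bD _ bvC)].
- apply: bounded_measurableM; last exact: (bD _ bvC).
  exact: bounded_measurable_cst.
rewrite (nonneg _ _ bHB bvC HB0 vC0) sub0r.
by rewrite (nonneg (fun=> B) _ (bounded_measurable_cst _ _) bvC) ?oppr0.
Qed.

End markov_property.

(** * Lipschitz functions and the Wasserstein distance *)

(** Monotonicity without measurability: both integrals are suprema over simple
    functions below the integrand. It is applied to distances and to maximal
    partial sums, whose measurability thus need not be discussed. *)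
Lemma ge0_le_integralT d (T : measurableType d) (R : realType)
    (mu : {measure set T -> \bar R}) (f g : T -> \bar R) :
  (forall x, 0 <= f x) -> (forall x, f x <= g x) ->
  \int[mu]_x f x <= \int[mu]_x g x.
Proof.
move=> f0 fg; have g0 x : 0 <= g x by exact: le_trans (f0 x) (fg x).
rewrite !ge0_integralTE//; apply: le_ereal_sup => _ [h hf <-] /=.
by exists h => // x; exact: le_trans (hf x) (fg x).
Qed.

Section wasserstein_lipschitz.
Context d (T : measurableType d) (R : realType) (dist : T -> T -> R).
Hypothesis dist_metric : is_metric dist.

Let dist_ge0 x y : (0 <= dist x y)%R. Proof. by have [] := dist_metric. Qed.

Let dist_sym x y : dist x y = dist y x. Proof. by have [] := dist_metric. Qed.

Let dist_gt0 x y : x <> y -> (0 < dist x y)%R.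
Proof.
move=> xy; rewrite lt_neqAle dist_ge0 andbT eq_sym; apply/eqP => dxy.
by apply: xy; have [_ + _ _] := dist_metric; move=> /(_ x y) [+ _]; apply.
Qed.

Lemma wasserstein_ge0 (mu1 mu2 : set T -> \bar R) :
  0 <= wasserstein dist mu1 mu2.
Proof.
apply: le_ereal_inf_tmp => _ [eta _ <-].
by apply: integral_ge0 => z _; rewrite lee_fin.
Qed.

(** The easy half of the Kantorovich duality: for a coupling of the two
    measures, the difference of the means of [f] is the integral of
    f z.1 - f z.2, at most the transport cost. *)
Lemma le_wasserstein (mu1 mu2 : {measure set T -> \bar R}) (f : T -> R) :
  mu1 setT = 1 -> mu2 setT = 1 -> bounded_measurable f ->
  (forall x y, `|f x - f y| <= dist x y)%R ->
  ((\int[mu1]_x f x - \int[mu2]_x f x)%R)%:E <= wasserstein dist mu1 mu2.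
Proof.
move=> mu11 mu21 bf fd; apply: le_ereal_inf_tmp => _ [eta [c1 c2] <-].
have eta1 := @probability_setT _ _ _ eta.
have bf1 : bounded_measurable (fun z : T * T => f z.1).
  exact: (bounded_measurable_comp measurable_fst bf).
have bf2 : bounded_measurable (fun z : T * T => f z.2).
  exact: (bounded_measurable_comp measurable_snd bf).
have mfE : measurable_fun [set: T] (fun x => (f x)%:E).
  exact/measurable_EFinP/bf.1.
have -> : (\int[mu1]_x f x = \int[eta]_z f z.1)%R.
  have int := bounded_measurable_integrable eta1 bf1.
  congr fine.
  rewrite [RHS](esym (integral_pushforward measurable_fst mfE int measurableT)).
  apply: eq_measure_integral => A mA _; rewrite -c1//= /pushforward.
  by congr (eta _); apply/seteqP; split => z //= [].
have -> : (\int[mu2]_x f x = \int[eta]_z f z.2)%R.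
  have int := bounded_measurable_integrable eta1 bf2.
  congr fine.
  rewrite [RHS](esym (integral_pushforward measurable_snd mfE int measurableT)).
  apply: eq_measure_integral => A mA _; rewrite -c2//= /pushforward.
  by congr (eta _); apply/seteqP; split => z //= [].
have bD : bounded_measurable (fun z : T * T => f z.1 - f z.2)%R.
  exact: bounded_measurableB.
have iD := bounded_measurable_integrable eta1 bD.
rewrite -Rintegral_bmB//.
apply: (@le_trans _ _ (\int[eta]_z `|(f z.1 - f z.2)%:E|)).
  rewrite EFin_Rintegral//; apply: le_trans (le_abse_integral _ measurableT _).
    exact: lee_abs.
  by apply/measurable_EFinP; exact: bD.1.
by apply: ge0_le_integralT => // z; rewrite abse_EFin lee_fin.
Qed.

Hypothesis nontrivial : exists x y : T, x <> y.

Lemma tau_ge0 (K : R.-pker T ~> T) : 0 <= tau dist K.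
Proof.
have [x [y xy]] := nontrivial.
apply: le_trans (ereal_sup_ubound _); last by exists (x, y).
by rewrite mule_ge0 ?wasserstein_ge0// lee_fin invr_ge0.
Qed.

Lemma kernel_mean_lipschitz (K : R.-pker T ~> T) (f : T -> R) :
  bounded_measurable f -> (forall x y, `|f x - f y| <= dist x y)%R ->
  tau dist K < +oo ->
  forall x y, (`|kernel_mean K f x - kernel_mean K f y|
               <= fine (tau dist K) * dist x y)%R.
Proof.
move=> bf fd Koo.
have Kfin : tau dist K \is a fin_num by rewrite ge0_fin_numE ?tau_ge0.
have tau0 : (0 <= fine (tau dist K))%R by rewrite fine_ge0 ?tau_ge0.
have K1 x := prob_kernel (s := K) x.
have half x y : (kernel_mean K f x - kernel_mean K f y <=
    fine (tau dist K) * dist x y)%R.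
  have [->|xy] := pselect (x = y); first by rewrite subrr mulr_ge0.
  have d0 := dist_gt0 xy.
  rewrite -lee_fin; apply: le_trans (le_wasserstein (K1 x) (K1 y) bf fd) _.
  rewrite EFinM fineK// -lee_pdivrMr//.
  by apply: ereal_sup_ubound; exists (x, y).
move=> x y; rewrite ler_norml half andbT lerNl opprB.
by rewrite dist_sym half.
Qed.

End wasserstein_lipschitz.

Section iterates.
Context d (T : measurableType d) (R : realType) (P : R.-pker T ~> T).

Lemma kernel_mean_kiter0 (f : T -> R) : bounded_measurable f ->
  kernel_mean (kiter P 0) f = f.
Proof.
move=> bf; apply/funext => x.
rewrite /kernel_mean /Rintegral integral_dirac//; last first.
  by apply/measurable_EFinP; exact: bf.1.
by rewrite diracT mul1e.
Qed.

Lemma kernel_mean_kiterS n (f : T -> R) : bounded_measurable f ->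
  kernel_mean (kiter P n.+1) f = kernel_mean P (kernel_mean (kiter P n) f).
Proof.
move=> bf; apply/funext => x; apply: Rintegral_kernel_mixture => //.
exact: prob_kernel.
Qed.

Lemma invariant_kernel_mean (pi : probability T R) (f : T -> R) :
  invariant_measure P pi -> bounded_measurable f ->
  (\int[pi]_x kernel_mean P f x = \int[pi]_x f x)%R.
Proof.
move=> piP bf; apply/esym/Rintegral_kernel_mixture => //.
exact: probability_setT.
Qed.

Lemma invariant_kernel_mean_kiter (pi : probability T R) (f : T -> R) n :
  invariant_measure P pi -> bounded_measurable f ->
  (\int[pi]_x kernel_mean (kiter P n) f x = \int[pi]_x f x)%R.
Proof.
move=> piP bf; elim: n => [|n IHn]; first by rewrite kernel_mean_kiter0.
rewrite kernel_mean_kiterS// invariant_kernel_mean//.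
exact: bounded_measurable_kernel_mean.
Qed.

End iterates.

(** * Martingale decomposition of the partial sums *)

(** The functions [w k] solve the Poisson equation w = f + P w backwards in
    time, from time [n] down to [0]. Hence
    f (X k) = w k (X k) - (P (w k.+1)) (X k), and the partial sums telescope
    into the martingale [M], with increments [D], minus one bounded term. *)
Section maximal_inequality.
Context dO (Omega : measurableType dO) disp (T : measurableType disp)
  (R : realType) (Pr : probability Omega R) (X : nat -> {RV Pr >-> T})
  (P : R.-pker T ~> T) (nu : probability T R).
Hypothesis XP : markov_chain P nu X.

Variables (f : T -> R) (w : nat -> T -> R) (n : nat) (C : R).
Hypothesis bw : forall k, bounded_measurable (w k).
Hypothesis wC : forall k x, (`|w k x| <= C)%R.
Hypothesis wE : forall k x, (k <= n)%N ->
  w k x = (f x + kernel_mean P (w k.+1) x)%R.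

Let D (j : nat) (o : Omega) : R :=
  (w j.+1 (X j.+1 o) - kernel_mean P (w j.+1) (X j o))%R.

Let M (o : Omega) (k : nat) : R := (w 0%N (X 0%N o) + \sum_(j < k) D j o)%R.

Let MS o k : (M o k.+1 - M o k = D k o)%R.
Proof.
rewrite /M big_ord_recr /= opprD addrACA subrr add0r.
by rewrite addrAC subrr add0r.
Qed.

Let PwC k x : (`|kernel_mean P (w k) x| <= C)%R.
Proof. by apply: kernel_mean_le. Qed.

Let C0 : (0 <= C)%R. Proof. exact: le_trans (normr_ge0 _) (wC 0%N point). Qed.

Let partial_sumE o k : (k <= n)%N ->
  (\sum_(0 <= j < k.+1) f (X j o) = M o k - kernel_mean P (w k.+1) (X k o))%R.
Proof.
elim: k => [_|k IHk kn].
  by rewrite big_nat1 /M big_ord0 addr0 wE// addrK.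
rewrite big_nat_recr//= IHk 1?ltnW//.
have -> : f (X k.+1 o) =
    (w k.+1 (X k.+1 o) - kernel_mean P (w k.+2) (X k.+1 o))%R.
  by rewrite wE// addrK.
have := MS o k; rewrite /D => /eqP; rewrite subr_eq => /eqP ->.
by ring.
Qed.

Let max_partial_sum_le o :
  (max_partial_sum X f n.+1 o <= running_max (M o) n + C)%R.
Proof.
rewrite /max_partial_sum big_nat; apply: bigmax_le.
  rewrite addr_ge0//.
  exact: le_trans (normr_ge0 _) (running_max_ge _ (leq0n n)).
move=> [//|k] /= kn; rewrite partial_sumE//.
by rewrite (le_trans (ler_normB _ _))// lerD// running_max_ge.
Qed.

Let H (k : nat) (o : Omega) : R := doob_weight (M o) k.

(* Constants: (S + C)^2 <= 2 S^2 + 2 C^2; the pathwise inequality bounds S^2 by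
   4 (C^2 + n (2 C)^2) plus the transform, as |M 0| <= C and |D j| <= 2 C; and
   8 C^2 + 32 n C^2 <= 32 (n + 1) C^2. *)
Let sqr_max_partial_sum_le o :
  (max_partial_sum X f n.+1 o ^+ 2 <=
   32%:R * C ^+ 2 * n.+1%:R + 2%:R * C ^+ 2
   + 2%:R * \sum_(k < n) H k o * D k o)%R.
Proof.
have S0 : (0 <= max_partial_sum X f n.+1 o)%R by exact: bigmax_ge_id.
have := max_partial_sum_le o.
have := doob_pathwise (M o) n.
under eq_bigr do rewrite MS; under [X in (_ + X)%R]eq_bigr do rewrite MS.
set S := running_max _ _; set Z := (\sum_(k < n) H k o * D k o)%R.
set Y := (\sum_(k < n) D k o ^+ 2)%R.
have Mo : (M o 0%N ^+ 2 <= C ^+ 2)%R.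
  by rewrite /M big_ord0 addr0 -real_normK ?num_real// lerXn2r ?nnegrE.
have YC : (Y <= n%:R * (4%:R * C ^+ 2))%R.
  rewrite mulr_natl -[X in (_ *+ X)%R]card_ord -sumr_const.
  apply: ler_sum => k _; rewrite -real_normK ?num_real//.
  have -> : (4%:R * C ^+ 2 = (C + C) ^+ 2)%R by ring.
  rewrite lerXn2r ?nnegrE ?addr_ge0//.
  by rewrite (le_trans (ler_normB _ _))// lerD.
move=> SZ SC.
have : (max_partial_sum X f n.+1 o ^+ 2 <= (S + C) ^+ 2)%R.
  by rewrite lerXn2r ?nnegrE// (le_trans S0).
have := sqr_ge0 (S - C); have := sqr_ge0 C.
rewrite -natr1.
nra.
Qed.

Let bounded_measurable_X j k (v : T -> R) :
  (j <= k)%N -> bounded_measurable v ->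
  bounded_measurable (fun o : past X k => v (X j o)).
Proof.
move=> jk bv.
exact: (bounded_measurable_comp (measurable_past (X := X) jk) bv).
Qed.

Let bounded_measurable_M j k : (j <= k)%N ->
  bounded_measurable (fun o : past X k => M o j).
Proof.
move=> jk; apply: bounded_measurableD; first exact: bounded_measurable_X.
apply: (@bounded_measurable_sum _ (past X k)) => i ij.
apply: bounded_measurableB; apply: bounded_measurable_X => //.
- exact: leq_trans jk.
- by rewrite ltnW// (leq_trans ij).
- exact: bounded_measurable_kernel_mean.
Qed.

Let bounded_measurable_running_max j k : (j <= k)%N ->
  bounded_measurable (fun o : past X k => running_max (M o) j).
Proof.
elim: j => [|j IHj] jk /=.
  exact/bounded_measurable_norm/bounded_measurable_M.
apply: bounded_measurable_max; first by apply: IHj; exact: ltnW.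
exact/bounded_measurable_norm/bounded_measurable_M.
Qed.

Let bounded_measurable_H k : bounded_measurable (H k : past X k -> R).
Proof.
apply: bounded_measurableB; apply: bounded_measurableM.
- exact: bounded_measurable_cst.
- exact: bounded_measurable_M.
- exact: bounded_measurable_cst.
apply: bounded_measurableM; first exact: bounded_measurable_running_max.
exact/bounded_measurable_sg/bounded_measurable_M.
Qed.

Lemma expectation_sqr_max_partial_sum_le :
  'E_Pr[fun o => (max_partial_sum X f n.+1 o ^+ 2)%R] <=
  (32%:R * C ^+ 2 * n.+1%:R + 2%:R * C ^+ 2)%:E.
Proof.
have P1 := @probability_setT _ _ _ Pr.
have bHD k : bounded_measurable (fun o => H k o * D k o)%R.
  apply: bounded_measurableM.
    exact: (bounded_measurable_comp (measurable_to_past (X := X) (n := k))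
      (bounded_measurable_H k)).
  apply: bounded_measurableB;
    apply: (bounded_measurable_comp (measurable_funPT (X _))) => //.
  exact: bounded_measurable_kernel_mean.
rewrite unlock; set c := (32%:R * C ^+ 2 * n.+1%:R + 2%:R * C ^+ 2)%R.
apply: (@le_trans _ _ (\int[Pr]_o (c + 2%:R * \sum_(k < n) H k o * D k o)%:E)).
  apply: ge0_le_integralT => o; first by rewrite lee_fin sqr_ge0.
  by rewrite lee_fin; exact: sqr_max_partial_sum_le.
have bsum : bounded_measurable (fun o => \sum_(k < n) H k o * D k o)%R.
  exact: (@bounded_measurable_sum _ _ _ (fun k o => H k o * D k o)%R).
have b2sum :
    bounded_measurable (fun o => 2%:R * \sum_(k < n) H k o * D k o)%R.
  by apply: bounded_measurableM => //; exact: bounded_measurable_cst.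
have bc := bounded_measurable_cst Omega c.
rewrite -EFin_Rintegral//; last exact: bounded_measurableD.
rewrite Rintegral_bmD// Rintegral_prob_cst// RintegralZl//; last first.
  exact: bounded_measurable_integrable.
rewrite (Rintegral_bm_sum P1 (F := fun k o => H k o * D k o)%R)//.
(* each term is a function of the past at time k against an innovation *)
rewrite big1 ?mulr0 ?addr0// => k _.
exact: (markov_orthogonality XP).
Qed.

End maximal_inequality.

(** * Bounds on the potential and on the density *)

Section potential.
Context d (T : measurableType d) (R : realType) (P : R.-pker T ~> T)
  (f : T -> R).
Hypothesis bf : bounded_measurable f.

(** A partial sum of the potential f + P f + P^2 f + ..., which solves
    g = f + P g. With finitely many terms the equation links consecutive
    truncations instead, and no convergence has to be discussed. *)
Definition truncated_potential (m : nat) (x : T) : R :=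
  (\sum_(i < m) kernel_mean (kiter P i) f x)%R.

Let bu i : bounded_measurable (kernel_mean (kiter P i) f).
Proof. exact: bounded_measurable_kernel_mean. Qed.

Lemma bounded_measurable_truncated_potential m :
  bounded_measurable (truncated_potential m).
Proof.
by apply: (@bounded_measurable_sum _ _ _ (fun i => kernel_mean (kiter P i) f)).
Qed.

Lemma truncated_potentialS m x :
  truncated_potential m.+1 x =
  (f x + kernel_mean P (truncated_potential m) x)%R.
Proof.
rewrite /truncated_potential big_ord_recl kernel_mean_kiter0//; congr +%R.
transitivity (\sum_(i < m) kernel_mean P (kernel_mean (kiter P i) f) x)%R.
  by apply: eq_bigr => i _; rewrite -kernel_mean_kiterS.
by apply/esym/(Rintegral_bm_sum (prob_kernel x)
  (F := fun i => kernel_mean (kiter P i) f)).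
Qed.

End potential.

Section contraction.
Context d (T : measurableType d) (R : realType) (dist : T -> T -> R)
  (P : R.-pker T ~> T) (pi : probability T R) (f : T -> R).
Hypothesis dist_metric : is_metric dist.
Hypothesis nontrivial : exists x y : T, x <> y.
Hypothesis piP : invariant_measure P pi.
Hypothesis bf : bounded_measurable f.
Hypothesis f_lip : forall x y, (`|f x - f y| <= dist x y)%R.
Hypothesis f_mean0 : (\int[pi]_x f x = 0)%R.
Hypothesis diam_fin : diameter dist < +oo.

Lemma dist_le_diameter x y : (dist x y <= fine (diameter dist))%R.
Proof.
have le_diam : (dist x y)%:E <= diameter dist.
  by apply: ereal_sup_ubound; exists (x, y).
rewrite -lee_fin fineK// fin_numE (lt_eqF diam_fin) andbT.
by apply/eqP => dNy; move: le_diam; rewrite dNy leeNy_eq.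
Qed.

(** As [pi] is invariant, P^j f has mean 0 too, hence P^j f x is the mean over
    [y] of P^j f x - P^j f y. *)
Lemma kernel_mean_kiter_le j x : tau dist (kiter P j) < +oo ->
  (`|kernel_mean (kiter P j) f x| <=
   fine (tau dist (kiter P j)) * fine (diameter dist))%R.
Proof.
move=> tauy; have pi1 := @probability_setT _ _ _ pi.
have bu := bounded_measurable_kernel_mean (kiter P j) bf.
have bc := bounded_measurable_cst T (kernel_mean (kiter P j) f x).
have -> : kernel_mean (kiter P j) f x = (\int[pi]_y
    (kernel_mean (kiter P j) f x - kernel_mean (kiter P j) f y))%R.
  rewrite Rintegral_bmB// Rintegral_prob_cst//.
  by rewrite invariant_kernel_mean_kiter// f_mean0 subr0.
apply: Rintegral_normr_le => //; first exact: bounded_measurableB.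
move=> y; apply: le_trans
  (kernel_mean_lipschitz dist_metric nontrivial bf f_lip tauy x y) _.
by rewrite ler_wpM2l ?dist_le_diameter// fine_ge0// tau_ge0.
Qed.

Lemma truncated_potential_le m x : Lambda dist P < +oo ->
  (`|truncated_potential P f m x| <=
   fine (diameter dist) * fine (Lambda dist P))%R.
Proof.
move=> Ly.
have tau0 i : 0 <= tau dist (kiter P i) by exact: tau_ge0.
have partial k : \sum_(0 <= i < k) tau dist (kiter P i) <= Lambda dist P.
  by apply: nneseries_lim_ge => i _ _; exact: tau0.
have tauy i : tau dist (kiter P i) < +oo.
  apply: le_lt_trans Ly; apply: le_trans (partial i.+1).
  by rewrite big_nat_recr//= leeDr// sume_ge0.
have diam0 : (0 <= fine (diameter dist))%R.
  apply: le_trans (dist_le_diameter point point).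
  by have [] := dist_metric.
apply: le_trans (ler_norm_sum _ _ _) _.
apply: (@le_trans _ _ (\sum_(i < m)
    fine (tau dist (kiter P i)) * fine (diameter dist))%R).
  by apply: ler_sum => i _; exact: kernel_mean_kiter_le.
rewrite -mulr_suml mulrC ler_wpM2l// -lee_fin -sumEFin.
rewrite fineK; last first.
  by rewrite ge0_fin_numE//; apply: nneseries_ge0 => i _ _; exact: tau0.
apply: le_trans (partial m); rewrite big_mkord; apply: lee_sum => i _.
by rewrite fineK// ge0_fin_numE.
Qed.

End contraction.

Lemma lip_norm_le1 d (T : measurableType d) (R : realType)
    (dist : T -> T -> R) (f : T -> R) :
  is_metric dist -> lip_norm dist f <= 1 ->
  forall x y, (`|f x - f y| <= dist x y)%R.
Proof.
move=> [d0 dE _ _] f1 x y.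
have [->|xy] := pselect (x = y); first by rewrite subrr normr0.
have dgt0 : (0 < dist x y)%R.
  by rewrite lt_neqAle d0 andbT eq_sym; apply/eqP => /dE.
rewrite -[leRHS]mul1r -ler_pdivrMr// -lee_fin.
by apply: le_trans f1; apply: ereal_sup_ubound; exists (x, y).
Qed.

(** The density has integral 1 and [pi] is a probability, so this is the Holder
    inequality against the constant function 1. *)
Lemma Lnorm_density_ge1 d (T : measurableType d) (R : realType)
    (pi nu : probability T R) (q : R) : nu `<< pi -> (1 < q)%R ->
  1 <= 'N[pi]_q%:E['d (charge_of_finite_measure nu) '/d pi].
Proof.
move=> numu q1.
have q0 : (0 < q)%R by exact: lt_trans q1.
set h := 'd _ '/d _.
have hint : pi.-integrable setT h by exact: Radon_Nikodym_integrable.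
have hfin x : h x \is a fin_num by exact: Radon_Nikodym_fin_num.
have hE : h = EFin \o (fine \o h) by apply/funext => x /=; rewrite fineK.
have mh : measurable_fun setT (fine \o h).
  by apply/measurable_EFinP; rewrite -hE; exact: (measurable_int pi).
have inth : \int[pi]_x h x = 1.
  rewrite -(@probability_setT _ _ _ nu).
  by rewrite [RHS](Radon_Nikodym_integral
    (nu := charge_of_finite_measure nu) numu measurableT).
pose p := (q / (q - 1))%R.
have q10 : (0 < q - 1)%R by rewrite subr_gt0.
have p0 : (0 < p)%R by rewrite divr_gt0.
have qp : (q^-1 + p^-1 = 1)%R.
  by rewrite /p; field; rewrite !gt_eqF.
have Np1 : 'N[pi]_p%:E[EFin \o @cst T R 1%R] = 1.
  rewrite (_ : EFin \o _ = cst 1)// Lnorm_cst1.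
  rewrite [X in X `^ _](_ : _ = 1) ?poweR1r//.
  exact: (@probability_setT _ _ _ pi).
have := hoelder pi mh (measurable_cst (1%R : R)) q0 p0 qp.
rewrite Np1 mule1 -hE.
apply: le_trans; rewrite Lnorm1 -[leLHS]abse1 -inth.
apply: le_trans (le_abse_integral pi measurableT _) _.
  exact: (measurable_int pi).
apply: ge0_le_integralT => // x.
by rewrite -[in leLHS](fineK (hfin x)) /= mulr1.
Qed.

(** * The maximal inequality for the chain *)

Theorem theorem4p5 (R : realType) (disp : measure_display)
    (T : polishBorelType disp R) (d : T -> T -> R)
    (P : R.-pker T ~> T) (pi nu : probability T R)
    (dO : measure_display) (Omega : measurableType dO)
    (Pr : probability Omega R) (X : nat -> {RV Pr >-> T}) (q : R) :
  (exists x y : T, x <> y) ->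
  is_metric d ->
  lower_semicontinuous (fun z : T * T => (d z.1 z.2)%:E) ->
  wasserstein_contractive d P ->
  invariant_measure P pi ->
  (forall mu : probability T R, invariant_measure P mu ->
     forall A, measurable A -> mu A = pi A) ->
  markov_chain P nu X ->
  diameter d < +oo ->
  nu `<< pi ->
  (1 < q)%R ->
  'N[pi]_q%:E['d (charge_of_finite_measure nu) '/d pi] < +oo ->
  forall n : nat, (0 < n)%N ->
  let C := diameter d * Lambda d P in
  ereal_sup [set 'E_Pr[fun w => (max_partial_sum X f n w ^+ 2)%R]
            | f in [set f | Lip0 d pi f /\ lip_norm d f <= 1]]
  <= 32%:R%:E * C ^+ 2 * n%:R%:E
       * 'N[pi]_q%:E['d (charge_of_finite_measure nu) '/d pi]
     + 2%:R%:E * C ^+ 2.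
Proof.
move=> nontriv dmet _ _ piP _ XP diamy numu q1 _ [//|n] _; lazy zeta.
set C := diameter d * Lambda d P.
apply: ge_ereal_sup => _ [f [[[mf _] f_int0] f1] <-].
have N1 := Lnorm_density_ge1 numu q1.
set N := 'N[pi]_q%:E[_] in N1 *.
have fd := lip_norm_le1 dmet f1.
have bf : bounded_measurable f.
  split=> //; exists (`|f point| + fine (diameter d))%R => x.
  rewrite -[f x](subrK (f point)) addrC (le_trans (ler_normD _ _))// lerD//.
  exact: le_trans (fd _ _) (dist_le_diameter diamy _ _).
have f_mean0 : (\int[pi]_x f x = 0)%R by rewrite /Rintegral f_int0.
have diam_gt0 : 0 < diameter d.
  have [x [y xy]] := nontriv; have [d0 dE _ _] := dmet.
  apply: (@lt_le_trans _ _ (d x y)%:E); last first.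
    by apply: ereal_sup_ubound; exists (x, y).
  by rewrite lte_fin lt_neqAle d0 andbT eq_sym; apply/eqP => /dE.
have Lambda0 : 0 <= Lambda d P.
  by apply: nneseries_ge0 => i _ _; exact: tau_ge0.
have C0 : 0 <= C by rewrite mule_ge0// ltW.
have lhs0 : 0 <= 32%:R%:E * C ^+ 2 * n.+1%:R%:E * N.
  apply: mule_ge0; last exact: Lnorm_ge0.
  apply: mule_ge0; last by rewrite lee_fin.
  by apply: mule_ge0; [rewrite lee_fin|exact: expe_ge0].
(* if the series diverges, the right-hand side is infinite *)
have [Ly|] := eqVneq (Lambda d P) +oo.
  have Cy : C = +oo by rewrite /C Ly gt0_muley.
  rewrite [X in _ + X](_ : _ = +oo); last first.
    by rewrite Cy expe2 mulyy gt0_muley// lte_fin.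
  by rewrite addey ?leey// gt_eqF// (lt_le_trans _ lhs0).
rewrite -ltey => Ly.
have CE : C = (fine (diameter d) * fine (Lambda d P))%:E.
  rewrite EFinM !fineK//; last by rewrite ge0_fin_numE// ltW.
  by rewrite ge0_fin_numE.
set c := (fine (diameter d) * fine (Lambda d P))%R in CE.
apply: (@le_trans _ _ (32%:R * c ^+ 2 * n.+1%:R + 2%:R * c ^+ 2)%:E).
  apply: (expectation_sqr_max_partial_sum_le XP
    (w := fun k => truncated_potential P f (n.+1 - k))).
  - by move=> k; exact: bounded_measurable_truncated_potential.
  - by move=> k x; exact: (truncated_potential_le dmet nontriv piP).
  - by move=> k x kn; rewrite subSn// truncated_potentialS// subSS.
rewrite CE EFinD !EFinM -!EFin_expe leeD2r//.
rewrite -[leLHS]mule1 lee_wpmul2l// -!EFinM lee_fin.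
by rewrite mulr_ge0// mulr_ge0// sqr_ge0.
Qed.
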